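(* Let $\alpha,\beta\in\mathcal{D}_n$ with $\alpha\le\beta$. The number of solutions $(\chi,\upsilon)\in\mathcal{D}_n\times\mathcal{D}_n$ of the system $$\chi\wedge\upsilon=\alpha,\qquad \chi\vee\upsilon=\beta$$ is $$P(\alpha,\beta)=2^{C_{\alpha,\beta}},$$ where $C_{\alpha,\beta}$ is the number of connected components of the connection graph $C_\alpha(\beta)$.
   Context: Let $n\ge 0$ and $\mathcal{A}=\{1,\dots,n\}$. An antichain over $\mathcal{A}$ is a set of pairwise non-inclusive subsets of $\mathcal{A}$ (the empty set of subsets $\{\}$ and the singleton $\{\emptyset\}$ are both antichains). $\mathcal{D}_n$ is the set of all antichains over $\mathcal{A}$, partially ordered by: $\alpha\le\beta$ iff for every $X\in\alpha$ there is $Y\in\beta$ with $X\subseteq Y$. For a set $S$ of subsets of $\mathcal{A}$, $\max(S)$ is the set of inclusion-maximal members of $S$. Join and meet are $\alpha\vee\beta=\max(\alpha\cup\beta)$ and $\alpha\wedge\beta=\max(\{X\cap Y: X\in\alpha, Y\in\beta\})$. The symbol $-$ denotes set difference of antichains regarded as sets of subsets of $\mathcal{A}$. For $\alpha\le\beta$, two sets $A,B\in\beta-\alpha$ are directly connected with respect to $\alpha$ iff $\{A\cap B\}\not\le\alpha$. They are connected with respect to $\alpha$ iff they are directly connected or joined by a finite chain of sets in $\beta-\alpha$ in which consecutive sets are directly connected with respect to $\alpha$. The connection graph $C_\alpha(\beta)$ has the sets in $\beta-\alpha$ as vertices, with an edge between $A$ and $B$ iff $A,B$ are connected with respect to $\alpha$.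 (If $\alpha=\beta$ the graph is empty and $C_{\alpha,\beta}=0$.) *)

(* Defs.v *)
From mathcomp Require Import all_boot.
Set Implicit Arguments.
Unset Strict Implicit.
Unset Printing Implicit Defensive.

(* 'I_n stands for the ground set {1, ..., n}. *)
Section Antichains.
Variable n : nat.
Implicit Types (A B : {set 'I_n}) (S alpha beta : {set {set 'I_n}}).

Definition is_antichain S : bool :=
  [forall A in S, forall B in S, (A \subset B) ==> (A == B)].

Definition antichains : {set {set {set 'I_n}}} := [set S | is_antichain S].

Definition ac_le alpha beta : bool :=
  [forall A in alpha, exists B in beta, A \subset B].

Definition max_sets S : {set {set 'I_n}} := [set A | maxset (mem S) A].

Definition ac_join alpha beta : {set {set 'I_n}} := max_sets (alpha :|: beta).

Definition ac_meet alpha beta : {set {set 'I_n}} :=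
  max_sets [set A :&: B | A in alpha, B in beta].

Definition directly_connected alpha beta : rel {set 'I_n} :=
  [rel A B | [&& A \in beta :\: alpha, B \in beta :\: alpha
               & ~~ ac_le [set A :&: B] alpha]].

(* [connect] also allows the empty chain; this adds nothing when alpha and beta
   are antichains with alpha <= beta, see [directly_connected_refl]. *)
Definition connection_graph alpha beta : rel {set 'I_n} :=
  [rel A B | [&& A \in beta :\: alpha, B \in beta :\: alpha
               & connect (directly_connected alpha beta) A B]].

Definition nb_components alpha beta : nat :=
  n_comp (connection_graph alpha beta) (beta :\: alpha).

Lemma directly_connected_refl alpha beta A :
  is_antichain beta -> ac_le alpha beta ->
  A \in beta :\: alpha -> directly_connected alpha beta A A.
Proof.
move=> /forall_inP acb /forall_inP leab Avert.
rewrite /directly_connected /= Avert setIid /=.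
move: Avert; rewrite inE => /andP[ANa Ab]; apply: contra ANa => /forall_inP leA.
have /exists_inP[B Ba sAB] := leA A (set11 A).
have /exists_inP[C Cb sBC] := leab B Ba.
have /forall_inP/(_ C Cb)/implyP/(_ (subset_trans sAB sBC))/eqP eqAC := acb A Ab.
suff -> : A = B by [].
by apply/eqP; rewrite eqEsubset sAB eqAC.
Qed.

(* The two conditions under which [n_comp] counts connected components. *)
Lemma connection_graph_connect_sym alpha beta :
  connect_sym (connection_graph alpha beta).
Proof.
have dsym : symmetric (directly_connected alpha beta).
  by move=> A B; rewrite /directly_connected /= [A :&: B]setIC andbCA.
apply: sym_connect_sym => A B.
by rewrite /connection_graph /= (sym_connect_sym dsym) andbCA.
Qed.

Lemma connection_graph_closed alpha beta :
  closed (connection_graph alpha beta) (beta :\: alpha).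
Proof. by move=> A B /and3P[-> ->]. Qed.

End Antichains.

(* Main.v *)
Require Import Defs.
From mathcomp Require Import all_boot.

(** An antichain is determined by the down-set it generates, and every down-set
    arises this way, as the one generated by its maximal members. Under this
    correspondence meet and join become intersection and union
    ([downset_meet], [downset_join]). Writing D for the generated down-set, the
    task is to count the pairs of down-sets U, W with intersection D(alpha) and
    union D(beta).

    Since beta is an antichain above alpha, no vertex B in beta - alpha lies in
    D(alpha) ([vertex_notin_downset]); hence B lies in exactly one of U and W.
    Put T for the set of vertices lying in U. If A in T and B not in T
    were directly connected, then A :&: B would lie in both U and W,
    hence in D(alpha), a contradiction: so T is a union of components. Conversely
    T determines the solution, since U = D(alpha :|: T) and W is generated by
    alpha and the remaining vertices, and every union of components T gives a
    solution in this way ([solutions_imset]). Finally, a union of components is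
    a free choice of a set of components ([card_closed_subsets]), which gives
    the power of 2. *)

Set Implicit Arguments.
Unset Strict Implicit.
Unset Printing Implicit Defensive.

(** * Closed sets of a finite graph *)

Section ClosedSubsets.
Variables (T : finType) (e : rel T).
Implicit Types (a S : {set T}).

Definition closed_subsets a : {set {set T}} :=
  [set S in powerset a |
     [forall x, forall y, e x y ==> ((x \in S) == (y \in S))]].

Lemma closed_subsetsP a S :
  reflect (S \subset a /\ closed e S) (S \in closed_subsets a).
Proof.
rewrite !inE; apply: (iffP andP) => -[sSa clS]; split=> //.
  by move=> x y exy; move/forallP/(_ x)/forallP/(_ y)/implyP/(_ exy)/eqP: clS.
by apply/forallP=> x; apply/forallP=> y; apply/implyP=> /clS->.
Qed.

(** A closed set is recovered from the component representatives ([roots e])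
    that it contains, and any set of representatives can be prescribed. *)
Lemma card_closed_subsets a :
  connect_sym e -> closed e a -> #|closed_subsets a| = 2 ^ n_comp e a.
Proof.
move=> esym cla.
pose reps := [set x | (x \in roots e) && (x \in a)].
pose saturate (R : {set T}) := [set x in a | root e x \in R].
have root_mem S x : closed e S -> (root e x \in S) = (x \in S).
  by move=> clS; rewrite -(closed_connect clS (connect_root e x)).
have -> : closed_subsets a = saturate @: powerset reps.
  apply/setP=> S; apply/closed_subsetsP/imsetP=> [[sSa clS]|[R sR ->]].
    exists (S :&: reps); first by rewrite inE subsetIr.
    apply/setP=> x; rewrite !inE (root_mem S) // (root_mem a) //.
    rewrite (roots_root esym) /=.
    by case xS: (x \in S); rewrite ?andbF // (subsetP sSa).
  split; first by apply/subsetP=> x; rewrite inE => /andP[].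
  move=> x y exy; rewrite !inE (cla _ _ exy).
  by rewrite (rootP esym (connect1 exy)).
have saturateK R : R \in powerset reps -> saturate R :&: reps = R.
  rewrite inE => /subsetP sR; apply/setP=> x; rewrite !inE.
  apply/idP/idP=> [/and3P[/andP[_ Rx] /eqP rx _]|Rx]; first by rewrite -rx.
  have := sR x Rx; rewrite !inE => /andP[rx ->].
  by rewrite rx (eqP rx) Rx.
rewrite card_in_imset; last first.
  by move=> R R' /saturateK{2}<- /saturateK{2}<- ->.
by rewrite card_powerset; congr (2 ^ _); apply: eq_card => x; rewrite !inE.
Qed.

End ClosedSubsets.

(** * Antichains and down-sets *)

Section Downsets.
Variable n : nat.
Implicit Types (A B X : {set 'I_n}) (S alpha beta : {set {set 'I_n}}).

Definition downset S : {set {set 'I_n}} :=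
  [set X : {set 'I_n} | [exists A in S, X \subset A]].

Lemma downsetP S X :
  reflect (exists2 A, A \in S & X \subset A) (X \in downset S).
Proof. by rewrite inE; apply: (iffP exists_inP). Qed.

Lemma ac_leE alpha beta : ac_le alpha beta = (alpha \subset downset beta).
Proof.
by apply/forall_inP/subsetP=> le A /le; rewrite inE.
Qed.

Lemma downset_sub X A S : X \subset A -> A \in downset S -> X \in downset S.
Proof.
by move=> sXA /downsetP[B SB sAB]; apply/downsetP; exists B; rewrite ?(subset_trans sXA).
Qed.

Lemma mem_downset A S : A \in S -> A \in downset S.
Proof. by move=> SA; apply/downsetP; exists A. Qed.

Lemma downset_mono alpha beta :
  alpha \subset downset beta -> downset alpha \subset downset beta.
Proof.
move=> /subsetP le; apply/subsetP=> X /downsetP[A aA sXA].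
exact: downset_sub sXA (le A aA).
Qed.

Lemma downsetU alpha beta :
  downset (alpha :|: beta) = downset alpha :|: downset beta.
Proof.
apply/setP=> X; rewrite in_setU.
apply/downsetP/orP=> [[A]|[] /downsetP[A AS sXA]].
- by rewrite inE => /orP[] AS sXA; [left | right]; apply/downsetP; exists A.
- by exists A; rewrite // inE AS.
- by exists A; rewrite // inE AS orbT.
Qed.

Lemma antichainP S :
  reflect {in S &, forall A B, A \subset B -> A = B} (S \in antichains n).
Proof.
rewrite inE; apply: (iffP forall_inP) => acS A.
  by move=> B SA SB sAB; apply/eqP; move/forall_inP/(_ B SB)/implyP: (acS A SA); apply.
by move=> SA; apply/forall_inP=> B SB; apply/implyP=> sAB; apply/eqP/acS.
Qed.

Lemma max_sets_antichain S : max_sets S \in antichains n.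
Proof.
apply/antichainP=> A B; rewrite !inE => /maxsetP[_ maxA] /maxsetP[SB _] sAB.
by rewrite (maxA B).
Qed.

Lemma downset_max S : downset (max_sets S) = downset S.
Proof.
apply/setP=> X; apply/downsetP/downsetP=> -[A AS sXA].
  by move: AS; rewrite inE => /maxsetP[SA _]; exists A.
have [B maxB sAB] := maxset_exists (P := mem S) AS.
by exists B; rewrite ?inE // (subset_trans sXA).
Qed.

Lemma downset_join alpha beta :
  downset (ac_join alpha beta) = downset alpha :|: downset beta.
Proof. by rewrite downset_max downsetU. Qed.

Lemma downset_meet alpha beta :
  downset (ac_meet alpha beta) = downset alpha :&: downset beta.
Proof.
rewrite downset_max; apply/setP=> X; rewrite in_setI.
apply/downsetP/andP=> [[_ /imset2P[A B aA bB ->]]|].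
  by rewrite subsetI => /andP[sXA sXB]; split; apply/downsetP; [exists A | exists B].
move=> [/downsetP[A aA sXA] /downsetP[B bB sXB]].
by exists (A :&: B); [apply: imset2_f | rewrite subsetI sXA].
Qed.

Lemma downset_inj : {in antichains n &, injective downset}.
Proof.
suff sub alpha beta : alpha \in antichains n ->
    downset alpha = downset beta -> alpha \subset beta.
  by move=> alpha beta aca acb eqD; apply/eqP; rewrite eqEsubset !sub.
move=> /antichainP aca eqD; apply/subsetP=> A aA.
have /downsetP[B bB sAB]: A \in downset beta by rewrite -eqD mem_downset.
have /downsetP[C aC sBC]: B \in downset alpha by rewrite eqD mem_downset.
have eqAC := aca A C aA aC (subset_trans sAB sBC).
suff -> : A = B by [].
by apply/eqP; rewrite eqEsubset sAB eqAC.
Qed.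

Lemma antichain_eqE alpha beta :
  alpha \in antichains n -> beta \in antichains n ->
  (alpha == beta) = (downset alpha == downset beta).
Proof. by move=> aca acb; rewrite (inj_in_eq downset_inj). Qed.

End Downsets.

(** * Solutions of the system *)

Section Solutions.
Variables (n : nat) (alpha beta : {set {set 'I_n}}).
Hypotheses (alpha_ac : alpha \in antichains n) (beta_ac : beta \in antichains n).
Hypothesis le_alpha_beta : ac_le alpha beta.
Implicit Types (A B X : {set 'I_n}) (T chi upsilon : {set {set 'I_n}}).

Local Notation V := (beta :\: alpha).
Local Notation dc := (directly_connected alpha beta).

Definition solutions : {set {set {set 'I_n}} * {set {set 'I_n}}} :=
  [set p in setX (antichains n) (antichains n) |
     (ac_meet p.1 p.2 == alpha) && (ac_join p.1 p.2 == beta)].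

(** The join with alpha supplies the part of the down-set common to both sides;
    joining takes maximal members because alpha and T need not form an antichain
    together. *)
Definition split_at T := (ac_join alpha T, ac_join alpha (V :\: T)).

Lemma solutionsP chi upsilon :
  reflect [/\ chi \in antichains n, upsilon \in antichains n,
              downset chi :&: downset upsilon = downset alpha
            & downset chi :|: downset upsilon = downset beta]
          ((chi, upsilon) \in solutions).
Proof.
have -> : ((chi, upsilon) \in solutions) = [&& chi \in antichains n,
    upsilon \in antichains n, ac_meet chi upsilon == alpha
    & ac_join chi upsilon == beta] by rewrite [LHS]in_set in_setX -andbA.
rewrite (antichain_eqE (max_sets_antichain _) alpha_ac).
rewrite (antichain_eqE (max_sets_antichain _) beta_ac).
rewrite downset_meet downset_join.
by apply: (iffP and4P) => -[? ? /eqP ? /eqP ?]; split=> //; apply/eqP.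
Qed.

Lemma downset_alpha_beta : downset alpha \subset downset beta.
Proof. by rewrite downset_mono // -ac_leE. Qed.

(** A member of alpha above a vertex would lie between two members of the
    antichain beta, so it would be equal to the vertex, which is not in alpha.
    This is the same fact as the direct connection of a vertex to itself. *)
Lemma vertex_notin_downset B : B \in V -> B \notin downset alpha.
Proof.
move=> VB; have beta_is_ac : is_antichain beta by move: beta_ac; rewrite inE.
have := directly_connected_refl beta_is_ac le_alpha_beta VB.
by case/and3P=> _ _; rewrite setIid ac_leE sub1set.
Qed.

Lemma not_dc_downset A B :
  A \in V -> B \in V -> ~~ dc A B -> A :&: B \in downset alpha.
Proof. by move=> VA VB; rewrite /directly_connected /= VA VB negbK ac_leE sub1set. Qed.

(** The edges of the connection graph are the chains of direct connections, so
    both relations have the same closed sets of vertices. *)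
Lemma closed_connection_graph T :
  closed (connection_graph alpha beta) T <-> closed dc T.
Proof.
split=> clT A B; last by case/and3P=> _ _ /(closed_connect clT).
move=> dcAB; apply: clT; case/and3P: (dcAB) => VA VB _.
by rewrite /connection_graph /= VA VB connect1.
Qed.

Lemma vertex_in_downset_join T B :
  T \subset V -> B \in V -> (B \in downset (ac_join alpha T)) = (B \in T).
Proof.
move=> sTV VB; rewrite downset_join in_setU (negPf (vertex_notin_downset VB)) /=.
apply/idP/idP=> [/downsetP[C TC sBC]|/mem_downset //].
suff -> : B = C by [].
have := subsetP sTV C TC; move: VB; rewrite !inE => /andP[_ bB] /andP[_ bC].
by apply: (antichainP _ beta_ac).
Qed.

Lemma split_at_inj :
  {in closed_subsets (connection_graph alpha beta) V &, injective split_at}.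
Proof.
move=> T T' /closed_subsetsP[sT _] /closed_subsetsP[sT' _] [eqJ _].
apply/setP=> B; have [VB|nVB] := boolP (B \in V).
  by rewrite -(vertex_in_downset_join sT) // eqJ vertex_in_downset_join.
by rewrite !(contraNF (subsetP _ B) nVB).
Qed.

(** If X lies below A in T and B outside T, then X lies below A :&: B, which is
    below alpha because a closed T has no direct connection to the outside. *)
Lemma split_at_solution T :
  T \subset V -> closed dc T -> split_at T \in solutions.
Proof.
move=> sTV clT; apply/solutionsP; rewrite !max_sets_antichain !downset_join.
rewrite -setUIr -setUUr -downsetU; split=> //; last first.
  have -> : T :|: V :\: T = V by rewrite setDE setUIr setUCr setIT (setUidPr sTV).
  rewrite -downsetU setDE setUIr setUCr setIT downsetU.
  exact/setUidPr/downset_alpha_beta.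
apply/setUidPl/subsetP=> X; rewrite in_setI.
case/andP=> /downsetP[A TA sXA] /downsetP[B].
rewrite in_setD => /andP[nTB VB] sXB.
apply: (@downset_sub _ _ (A :&: B)); first by rewrite subsetI sXA.
apply: not_dc_downset => //; first exact: (subsetP sTV).
by apply: contra nTB => /clT <-.
Qed.

(** The set T is forced to be the set of vertices below chi. A member X of the
    down-set of chi lies below some B in beta; if B is neither in alpha nor in T
    then B lies below upsilon, so X lies below both and hence below alpha.
    The argument for upsilon is the same. *)
Lemma solution_split_at chi upsilon :
  (chi, upsilon) \in solutions ->
  exists2 T : {set {set 'I_n}}, T \subset V /\ closed dc T & (chi, upsilon) = split_at T.
Proof.
case/solutionsP=> acc acu eqI eqU.
have inI X : X \in downset chi -> X \in downset upsilon -> X \in downset alpha.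
  by move=> cX uX; rewrite -eqI in_setI cX.
have inU B : B \in V -> (B \in downset upsilon) = (B \notin downset chi).
  move=> VB; have /negP naB := vertex_notin_downset VB.
  have : B \in downset beta by case/setDP: VB => /mem_downset.
  rewrite -eqU in_setU.
  by case cB: (B \in downset chi) => //= _; apply/negP=> /(inI _ cB).
have /subsetP leac : downset alpha \subset downset chi by rewrite -eqI subsetIl.
have /subsetP leau : downset alpha \subset downset upsilon by rewrite -eqI subsetIr.
have belowV X : X \in downset beta ->
    X \in downset alpha \/ exists2 B, B \in V & X \subset B.
  case/downsetP=> B bB sXB; have [aB|naB] := boolP (B \in alpha).
    by left; apply: downset_sub sXB (mem_downset aB).
  by right; exists B; rewrite // in_setD naB.
pose T := [set B in V | B \in downset chi].
have VT B : (B \in V :\: T) = (B \in V) && (B \in downset upsilon).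
  by rewrite in_setD [B \in T]inE; have [/inU->|] := boolP (B \in V); rewrite ?andbF ?andbT.
exists T.
  have sTV : T \subset V by apply/subsetP=> B; rewrite inE => /andP[].
  split=> // A B dcAB; case/and3P: (dcAB) => VA VB.
  rewrite ac_leE sub1set => naAB.
  rewrite [A \in T]inE [B \in T]inE VA VB /=.
  (* Opposite sides would put the intersection of A and B below alpha. *)
  apply: contraNeq naAB => neq.
  have [cA|ncA] := boolP (A \in downset chi).
    have uB : B \in downset upsilon by rewrite inU //; move: neq; rewrite cA; case: (B \in _).
    by apply: inI; [apply: downset_sub cA | apply: downset_sub uB]; rewrite ?subsetIl ?subsetIr.
  have cB : B \in downset chi by move: neq; rewrite (negPf ncA); case: (B \in _).
  have uA : A \in downset upsilon by rewrite inU.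
  by apply: inI; [apply: downset_sub cB | apply: downset_sub uA]; rewrite ?subsetIl ?subsetIr.
congr (_, _); apply: downset_inj; rewrite ?max_sets_antichain // downset_join;
  apply/eqP; rewrite eqEsubset subUset; apply/and3P; split.
- apply/subsetP=> X cX; rewrite in_setU.
  have /belowV[->//|[B VB sXB]] : X \in downset beta by rewrite -eqU in_setU cX.
  have [cB|ncB] := boolP (B \in downset chi).
    by apply/orP; right; apply/downsetP; exists B; rewrite // inE VB.
  by rewrite inI // (downset_sub sXB) // inU.
- exact/subsetP.
- by apply: downset_mono; apply/subsetP=> B; rewrite inE => /andP[].
- apply/subsetP=> X uX; rewrite in_setU.
  have /belowV[->//|[B VB sXB]] : X \in downset beta by rewrite -eqU in_setU uX orbT.
  have [uB|] := boolP (B \in downset upsilon).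
    by apply/orP; right; apply/downsetP; exists B; rewrite // VT VB.
  by rewrite inU // negbK => cB; rewrite inI // (downset_sub sXB).
- exact/subsetP.
- by apply: downset_mono; apply/subsetP=> B; rewrite VT => /andP[].
Qed.

Lemma solutions_imset :
  solutions = split_at @: closed_subsets (connection_graph alpha beta) V.
Proof.
apply/setP=> -[chi upsilon]; apply/idP/imsetP.
  case/solution_split_at=> T [sTV clT] ->; exists T => //.
  by apply/closed_subsetsP; split=> //; apply/closed_connection_graph.
by case=> T /closed_subsetsP[sTV /closed_connection_graph clT] ->; apply: split_at_solution.
Qed.

Lemma card_solutions : #|solutions| = 2 ^ nb_components alpha beta.
Proof.
rewrite solutions_imset (card_in_imset split_at_inj) card_closed_subsets //.
  exact: connection_graph_connect_sym.
exact: connection_graph_closed.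
Qed.

End Solutions.

Theorem corollary5p5 (n : nat) (alpha beta : {set {set 'I_n}})
    (alpha_ac : alpha \in antichains n) (beta_ac : beta \in antichains n)
    (le_alpha_beta : ac_le alpha beta) :
  #|[set p in setX (antichains n) (antichains n) |
       (ac_meet p.1 p.2 == alpha) && (ac_join p.1 p.2 == beta)]|
  = 2 ^ nb_components alpha beta.
Proof. exact: card_solutions. Qed.
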